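(* Let $V=\{(x_1,\dots,x_6)\in\mathbb{C}^6\mid x_1+\cdots+x_6=0\}$ and identify $\mathbb{P}(V)\simeq\mathbb{P}^4$. For $1\le i<j\le 6$ let $z_{ij}=[v_{ij}]\in\mathbb{P}(V)$, where $v_{ij}=e_i+e_j-\frac13(e_1+\cdots+e_6)$. Then the set of fifteen points $$Z_{\mathrm{CR}}=\{z_{ij}\mid 1\le i<j\le 6\}\subset\mathbb{P}^4$$ is a $(5,3)$-geprofi set.
   Context: $e_1,\dots,e_6$ is the standard basis of $\mathbb{C}^6$, and $\mathbb{P}(V)$ is the projective space of one-dimensional subspaces of $V$. A finite set $Z\subset\mathbb{P}^4$ of $bd$ points is called a $(b,d)$-geprofi set if, for a general projection $\pi_P:\mathbb{P}^4\dashrightarrow\mathbb{P}^3$ from a point $P\in\mathbb{P}^4$ (i.e. for all $P$ in some nonempty Zariski open subset of $\mathbb{P}^4$), the image $\pi_P(Z)\subset\mathbb{P}^3$ is a full intersection of a curve of degree $b$ and a surface of degree $d$. Here full intersection means that $\pi_P(Z)$ consists of $bd$ points and there are a (reduced, purely one-dimensional, possibly reducible) curve $C\subset\mathbb{P}^3$ of degree $b$ and a (possibly reducible) surface $S\subset\mathbb{P}^3$ of degree $d$ with $C\cap S=\pi_P(Z)$. *)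

(* Defs.v *)
From HB Require Import structures.
From mathcomp Require Import all_boot all_order all_algebra.
From mathcomp Require Import boolp classical_sets cardinality.
From mathcomp Require Import reals.
From mathcomp Require Import mpoly.
From mathcomp Require Import complex.

Set Implicit Arguments.
Unset Strict Implicit.
Unset Printing Implicit Defensive.

Import GRing.Theory Num.Theory.
Local Open Scope ring_scope.
Local Open Scope classical_set_scope.
Local Open Scope card_scope.

Section ProjectiveSpaces.
Variable K : closedFieldType.
Implicit Types W U : vectType K.

Definition proj W := {L : {vspace W} | \dim L == 1%N}.

Definition coords W (v : W) : 'I_(\dim {:W}) -> K :=
  fun i => coord (vbasis {:W}) i v.

(* Meaningful for homogeneous [p]; requiring that [p] vanishes on the whole
   line [x] avoids choosing a representative.  *)
Definition vanishes_at W (p : {mpoly K[\dim {:W}]}) (x : proj W) : Prop :=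
  forall v : W, v \in val x -> p.@[coords v] = 0.

Definition zero_locus W (I : set {mpoly K[\dim {:W}]}) : set (proj W) :=
  [set x : proj W | forall p, I p -> vanishes_at p x].

Definition zariski_closed W (A : set (proj W)) : Prop :=
  exists I : set {mpoly K[\dim {:W}]},
    (forall p, I p -> exists d, p \is d.-homog) /\ A = zero_locus I.

Definition zariski_open W (A : set (proj W)) : Prop := zariski_closed (~` A).

Definition generically W (Q : proj W -> Prop) : Prop :=
  exists O : set (proj W), [/\ zariski_open O, O !=set0 & O `<=` [set x | Q x]].

Definition irreducible_closed W (Y : set (proj W)) : Prop :=
  [/\ zariski_closed Y, Y !=set0 &
      forall A B, zariski_closed A -> zariski_closed B ->
        Y `<=` A `|` B -> Y `<=` A \/ Y `<=` B].

Definition irreducible_component W (Y A : set (proj W)) : Prop :=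
  [/\ irreducible_closed Y, Y `<=` A &
      forall Y', irreducible_closed Y' -> Y' `<=` A -> Y `<=` Y' -> Y' = Y].

Definition has_chain W (Y : set (proj W)) (k : nat) : Prop :=
  exists c : nat -> set (proj W),
    (forall i, (i <= k)%N -> irreducible_closed (c i) /\ c i `<=` Y) /\
    (forall i, (i < k)%N -> c i `<` c i.+1).

(* Krull dimension of a (nonempty) closed set. *)
Definition has_dim W (Y : set (proj W)) (k : nat) : Prop :=
  has_chain Y k /\ ~ has_chain Y k.+1.

Definition pure_dim W (A : set (proj W)) (k : nat) : Prop :=
  [/\ zariski_closed A, A !=set0 &
      forall Y, irreducible_component Y A -> has_dim Y k].

(* A point of [proj 'Hom(W, K^o)], the dual projective space, is a line of
   linear forms, i.e. a hyperplane of [proj W]. *)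
Definition hyperplane W (H : proj 'Hom(W, K^o)) : set (proj W) :=
  [set x : proj W | forall (f : 'Hom(W, K^o)) (v : W),
     f \in val H -> v \in val x -> f v = 0].

(* A curve is given by its set of points, hence carries the reduced structure;
   its degree is then the number of points of a general hyperplane section. *)
Definition curve_of_degree W (b : nat) (C : set (proj W)) : Prop :=
  pure_dim C 1 /\
  generically (fun H : proj 'Hom(W, K^o) => C `&` hyperplane H #= `I_b).

Definition squarefree n (F : {mpoly K[n]}) : Prop :=
  F != 0 /\ forall G H : {mpoly K[n]}, F = G * G * H -> (msize G <= 1)%N.

(* Used for [\dim {:W} = 4], where hypersurfaces are surfaces; the zero locus
   of a form has the degree of that form because the form is squarefree. *)
Definition hypersurface_of_degree W (d : nat) (S : set (proj W)) : Prop :=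
  exists F : {mpoly K[\dim {:W}]},
    [/\ (0 < d)%N, F \is d.-homog, squarefree F & S = zero_locus [set F]].

Definition full_intersection (b d : nat) (X : set (proj 'rV[K]_4)) : Prop :=
  X #= `I_(b * d)%N /\
  exists C S : set (proj 'rV[K]_4),
    [/\ curve_of_degree b C, hypersurface_of_degree d S & C `&` S = X].

(* Image under the rational map [proj W --> proj U] induced by [phi]; points
   contained in the kernel of [phi], where the map is undefined, are dropped. *)
Definition proj_image W U (phi : 'Hom(W, U)) (Z : set (proj W)) :
    set (proj U) :=
  [set y : proj U | exists2 z, Z z & val y = (phi @: val z)%VS].

(* The projection from [P] is induced by a linear map with kernel [P]; such a
   map to ['rV_4] is unique up to a linear change of coordinates, and every
   choice is required to work. *)
Definition geprofi (b d : nat) W (Z : set (proj W)) : Prop :=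
  [/\ \dim {:W} = 5%N,
      Z #= `I_(b * d)%N &
      generically (fun P : proj W =>
        forall phi : 'Hom(W, 'rV[K]_4), lker phi = val P ->
          full_intersection b d (proj_image phi Z))].

End ProjectiveSpaces.

Section CremonaRichmond.
Variable R : realType.
Local Notation C := R[i].

Definition coord_sum (x : 'rV[C]_6) : C^o := \sum_(i < 6) x 0 i.

Fact coord_sum_linear : linear coord_sum.
Proof.
move=> a x y; rewrite /coord_sum scaler_sumr -big_split /=.
by apply: eq_bigr => i _; rewrite !mxE.
Qed.

HB.instance Definition _ :=
  GRing.isLinear.Build C 'rV[C]_6 C^o _ coord_sum coord_sum_linear.

Definition hyperplaneV : {vspace 'rV[C]_6} := lker (linfun coord_sum).

Lemma mem_hyperplaneV (x : 'rV[C]_6) : (x \in hyperplaneV) = (\sum_(i < 6) x 0 i == 0).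
Proof. by rewrite memv_ker lfunE. Qed.

Definition evec (i : 'I_6) : 'rV[C]_6 := delta_mx 0 i.

Definition vCR (i j : 'I_6) : 'rV[C]_6 :=
  evec i + evec j - (3%:R)^-1 *: \sum_(k < 6) evec k.

Lemma vCR_in_V (i j : 'I_6) : vCR i j \in hyperplaneV.
Proof.
have sum_e k : coord_sum (evec k) = 1.
  rewrite /coord_sum (bigD1 k) //= mxE !eqxx big1 ?addr0 // => l lk.
  by rewrite mxE (negPf lk) andbF.
rewrite memv_ker lfunE /= /vCR linearB linearD linearZ linear_sum /= !sum_e.
under eq_bigr do rewrite sum_e.
rewrite sumr_const card_ord subr_eq0; apply/eqP.
have n3 : (3%:R : C) != 0 by rewrite pnatr_eq0.
rewrite /GRing.scale /= -[1 + 1]/(2%:R).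
by apply: (mulfI n3); rewrite mulrA mulfV // mul1r -natrM.
Qed.

Definition Z_CR : set (proj (subvs_of hyperplaneV)) :=
  [set z : proj (subvs_of hyperplaneV) | exists i j : 'I_6,
     (i < j)%N /\ val z = <[Subvs (vCR_in_V i j)]>%VS].

End CremonaRichmond.

(* Main.v *)
From HB Require Import structures.
Require Import Defs.
From mathcomp Require Import all_boot all_order all_algebra.
From mathcomp Require Import boolp classical_sets cardinality.
From mathcomp Require Import reals mpoly complex.
From mathcomp Require Import ring.

(** The fifteen points are indexed by the duads [ij] of a six-element set.
    When the duads [ij], [kl], [mn] form a syntheme,
    [v_ij + v_kl + v_mn = 0], so the three points are collinear.  Choose five
    synthemes that contain every duad exactly once (a synthematic total, that
    is, a 1-factorization of the complete graph K_6).  They give five pairwise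
    skew lines of P^4, each carrying three of the points.  The projections of
    these lines form the quintic curve.

    The cubic surface is a union of three planes.  With the vertices numbered
    0, ..., 5, the duads fall into three classes of five: each class consists
    of a duad of the syntheme 01|23|45 and the four duads that join the other
    two duads of this syntheme.  The five points of a class satisfy two
    independent linear equations [g = h = 0] on P^4, so together with the
    centre P they lie in a hyperplane [h(P) g - g(P) h = 0], whose projection
    from P is a plane of P^3.  Each of the five lines has one point in each
    class, so its projection meets the three planes in its own three points
    and nowhere else, as soon as no plane contains a point of another class.

    All that is asked of P is that finitely many nonzero linear forms do not
    vanish at it.  For two lines of the total, the union of their synthemes
    is a hexagon, and the form with alternating signs along this hexagon
    vanishes on both lines; if it does not vanish at P, the projected lines
    are disjoint.  For a point v outside a class, [h(P) g(v) - g(P) h(v)] is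
    a linear form in P, and it must not vanish either.

    The argument is split accordingly.  [curve_of_lines] shows that b disjoint
    lines form a curve of degree b: a proper closed subset of a line is finite
    ([closed_on_line]), hence a line is irreducible of dimension one, and a
    general hyperplane meets each line once.  [squarefree_prod_forms] shows
    that the product of the equations of the planes is squarefree, because
    linear forms are prime ([linear_form_prime]).  [geprofi_grid] deduces the
    geprofi property for any points [p k a] spread over lines and planes in
    this way, and the last part checks its hypotheses by finite
    computations on the duads. *)

Set Implicit Arguments.
Unset Strict Implicit.
Unset Printing Implicit Defensive.
Import GRing.Theory Num.Theory.
Local Open Scope ring_scope.
Local Open Scope classical_set_scope.
Local Open Scope card_scope.

(** * Algebraically closed fields are infinite *)

Section ClosedFields.
Variable K : closedFieldType.

(** A root of [X * \prod_(a <- s) (X - a) + 1] lies outside [s]; the factor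
    [X] makes this polynomial nonconstant even for empty [s]. *)
Lemma closed_field_avoid (s : seq K) : exists t, t \notin s.
Proof.
have sz : size (\prod_(a <- s) ('X - a%:P) * 'X + 1%:P) != 1%N.
  rewrite size_MXaddC oner_eq0 andbF size_prod_XsubC; exact: isT.
have /closed_rootP[t rt] := sz; exists t; apply/negP => ts.
move: rt; rewrite /root !hornerE (_ : _.[t] = 0) ?mul0r ?add0r ?oner_eq0 //.
by apply/eqP; rewrite -/(root _ _) root_prod_XsubC.
Qed.

Lemma closed_field_infinite (I : choiceType) (f : K -> I) :
  injective f -> infinite_set (range f).
Proof.
move=> fI /finite_seqP[s Es].
pose g (y : I) := if pselect (exists t, f t = y) is left h then projT1 (cid h) else 0.
have [t] := closed_field_avoid (map g s); case/negP.
have ts : f t \in s by have : [set` s] (f t) by rewrite -Es; exists t.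
apply/mapP; exists (f t) => //; rewrite /g; case: pselect => [h|]; last by case; exists t.
by apply: fI; rewrite (projT2 (cid h)).
Qed.

End ClosedFields.

(** * Closed subsets of projective spaces *)

Section Proj.
Variable K : closedFieldType.
Implicit Types W : vectType K.

Definition proj_of W (L : {vspace W}) (dL : \dim L = 1%N) : proj W :=
  exist (fun M : {vspace W} => \dim M == 1%N) L (introT eqP dL).

Definition pt W (v : W) (v0 : v != 0) : proj W :=
  proj_of (etrans (dim_vline v) (congr1 nat_of_bool v0)).

Lemma pt_repr W (x : proj W) : exists2 v, v != 0 & val x = <[v]>%VS.
Proof.
case: x => L /= dL; have v0 : vpick L != 0 by rewrite vpick0 -dimv_eq0 (eqP dL).
exists (vpick L) => //; apply/esym/eqP.
by rewrite eqEdim -memvE memv_pick (eqP dL) dim_vline v0.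
Qed.

Lemma mem_line_eq W (u v : W) : u != 0 -> u \in <[v]>%VS -> <[u]>%VS = <[v]>%VS.
Proof.
move=> u0 uv; apply/eqP; rewrite eqEdim -memvE uv /= !dim_vline u0.
by case: (v != 0).
Qed.

Lemma val_proj_mem W (x : proj W) v : v != 0 -> v \in val x -> val x = <[v]>%VS.
Proof. by have [u _ ->] := pt_repr x => v0 /(mem_line_eq v0) ->. Qed.

Lemma proj_mem_eq W (x y : proj W) v : v != 0 -> v \in val x -> v \in val y -> x = y.
Proof.
by move=> v0 /(val_proj_mem v0) vx /(val_proj_mem v0) vy; apply: val_inj; rewrite vx vy.
Qed.

Lemma proj_subv W (x : proj W) (U : {vspace W}) v :
  v != 0 -> v \in val x -> (val x <= U)%VS = (v \in U).
Proof. by move=> v0 /(val_proj_mem v0) ->; rewrite -memvE. Qed.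

Lemma coordsZ W a (v : W) : coords (a *: v) =1 fun i => a * coords v i.
Proof. by move=> i; rewrite /coords linearZ. Qed.

Lemma meval_homogZ n d (p : {mpoly K[n]}) a (x : 'I_n -> K) :
  p \is d.-homog -> p.@[fun i => a * x i] = a ^+ d * p.@[x].
Proof.
move=> /dhomogP hp; rewrite !mevalE mulr_sumr; apply: eq_big_seq => m /hp /= <-.
rewrite mulrCA; congr (_ * _); under eq_bigr do rewrite exprMn.
by rewrite big_split /= mdegE -expr_sum.
Qed.

(** For a form, vanishing can be tested on any one representative of the
    point. *)
Lemma vanishes_homogE W d (p : {mpoly K[\dim {:W}]}) (x : proj W) v :
  p \is d.-homog -> v != 0 -> v \in val x -> vanishes_at p x <-> p.@[coords v] = 0.
Proof.
move=> hp v0 vx; split=> [|pv u]; first exact.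
rewrite (val_proj_mem v0 vx) => /vlineP[a ->].
by rewrite (meval_eq _ (coordsZ a v)) (meval_homogZ _ _ hp) pv mulr0.
Qed.

(** The polynomial in the coordinates of [vbasis] that represents [g]. *)
Definition mpoly_of_form W (g : 'Hom(W, K^o)) : {mpoly K[\dim {:W}]} :=
  \sum_(i < \dim {:W}) g (vbasis {:W})`_i *: 'X_i.

Lemma meval_form W (g : 'Hom(W, K^o)) v : (mpoly_of_form g).@[coords v] = g v.
Proof.
rewrite /mpoly_of_form raddf_sum /= {2}(coord_vbasis (memvf v)) linear_sum /=.
by apply: eq_bigr => i _; rewrite mevalZ mevalXU linearZ mulrC.
Qed.

Lemma form_homog W (g : 'Hom(W, K^o)) : mpoly_of_form g \is 1.-homog.
Proof.
apply: rpred_sum => i _; apply: rpredZ; rewrite dhomogX; exact/eqP/mdeg1.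
Qed.

Lemma form_vanishesE W (g : 'Hom(W, K^o)) (x : proj W) :
  vanishes_at (mpoly_of_form g) x <-> (val x <= lker g)%VS.
Proof.
split=> [h|/subvP h u /h]; last by rewrite meval_form memv_ker => /eqP.
by apply/subvP => u /h /eqP; rewrite meval_form memv_ker.
Qed.

Definition coord_form W (i : 'I_(\dim {:W})) (v : W) : K^o := coord (vbasis {:W}) i v.

Fact coord_form_linear W (i : 'I_(\dim {:W})) : linear (coord_form i).
Proof. by move=> a u v; rewrite /coord_form linearP. Qed.

HB.instance Definition _ W i :=
  GRing.isLinear.Build K W K^o _ (@coord_form W i) (@coord_form_linear W i).

(** Subtract from [v] its projection to [U]: some coordinate of the difference
    is nonzero, and this coordinate, as a function of [v], vanishes on [U]. *)
Lemma separating_form W (U : {vspace W}) v :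
  v \notin U -> exists2 g : 'Hom(W, K^o), (U <= lker g)%VS & g v != 0.
Proof.
move=> vU; set w := v - projv U v.
have w0 : w != 0.
  by apply: contraNneq vU => /subr0_eq ->; apply: memv_proj.
have : exists i, coord (vbasis {:W}) i w != 0.
  apply/existsP; apply: contraNT w0 => /existsPn h.
  rewrite (coord_vbasis (memvf w)) big1 // => i _.
  by move/negbNE: (h i) => /eqP->; rewrite scale0r.
case=> i wi.
pose g : 'Hom(W, K^o) := (linfun (coord_form i) \o (\1 - projv U))%VF.
have gE u : g u = coord (vbasis {:W}) i (u - projv U u).
  by rewrite comp_lfunE lfunE add_lfunE opp_lfunE id_lfunE.
exists g; last by rewrite gE.
by apply/subvP => u uU; rewrite memv_ker gE projv_id // subrr linear0.
Qed.

Lemma closed_subspace W (U : {vspace W}) :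
  zariski_closed [set x : proj W | (val x <= U)%VS].
Proof.
exists [set mpoly_of_form g | g in [set g : 'Hom(W, K^o) | (U <= lker g)%VS]].
split; first by move=> _ [g _ <-]; exists 1%N; apply: form_homog.
rewrite eqEsubset; split=> x /=.
  by move=> xU _ [g gU <-]; apply/form_vanishesE; apply: subv_trans xU gU.
move=> h; apply/subvP => v vx; apply/negP => /negP/separating_form[g gU /eqP]; apply.
by rewrite -meval_form; apply: h vx; exists g.
Qed.

(** The union is cut out by the products of the equations.  Homogeneity is
    essential here: each factor is tested at a single representative. *)
Lemma closed_setU W (A B : set (proj W)) :
  zariski_closed A -> zariski_closed B -> zariski_closed (A `|` B).
Proof.
move=> [I [Ih ->]] [J [Jh ->]].
exists [set pq.1 * pq.2 | pq in [set pq | I pq.1 /\ J pq.2]]; split.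
  move=> _ [[p q] /= [/Ih[d hp] /Jh[e hq]] <-]; exists (d + e)%N; exact: dhomogM.
rewrite eqEsubset; split=> x.
  move=> xIJ _ [[p q] /= [Ip Jq] <-] v vx; rewrite mevalM; case: xIJ => h.
    by rewrite (h _ Ip _ vx) mul0r.
  by rewrite (h _ Jq _ vx) mulr0.
move=> h; have [hI|/existsNP[p /not_implyP[Ip px]]] := pselect (zero_locus I x); first by left.
right=> q Jq; have [[d hp] [e hq]] := (Ih _ Ip, Jh _ Jq).
have [v v0 vx] := pt_repr x; have {}vx : v \in val x by rewrite vx memv_line.
apply/(vanishes_homogE hq v0 vx); apply/eqP.
have : (p * q).@[coords v] == 0 by apply/eqP/h => //; exists (p, q).
rewrite mevalM mulf_eq0 => /orP[/eqP pv|//].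
by case: px; apply/(vanishes_homogE hp v0 vx).
Qed.

Lemma closed_set0 W : zariski_closed (set0 : set (proj W)).
Proof.
exists [set 1]; split; first by move=> _ ->; exists 0%N; apply: dhomog1.
rewrite eqEsubset; split=> x // /(_ 1 erefl 0 (mem0v _)).
by rewrite meval1 => /eqP; rewrite oner_eq0.
Qed.

Lemma closed_bigU W (I : eqType) (s : seq I) (F : I -> set (proj W)) :
  (forall i, zariski_closed (F i)) ->
  zariski_closed [set x | exists2 i, i \in s & F i x].
Proof.
move=> Fc; elim: s => [|i s IH].
  by rewrite (_ : mkset _ = set0); [exact: closed_set0 | apply/seteqP; split=> x // []].
have := closed_setU (Fc i) IH; congr zariski_closed; apply/seteqP; split=> x.
  case=> [xi|[j js xj]]; first by exists i; rewrite ?mem_head.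
  by exists j => //; rewrite inE js orbT.
case=> j; rewrite inE => /orP[/eqP-> xi|js xj]; first by left.
by right; exists j.
Qed.

(** If [v] avoids all the earlier subspaces but lies in [U], take [w] outside
    [U]: then [w + t v] is never in [U], and it meets each of the
    earlier subspaces for at most one value of [t]. *)
Lemma avoid_subspaces W (s : seq {vspace W}) :
  (0 < \dim {:W})%N -> (forall U, U \in s -> U != fullv) ->
  exists2 v, v != 0 & forall U, U \in s -> v \notin U.
Proof.
move=> W0 sf; suff [v vs] : exists v, forall U, U \in 0%VS :: s -> v \notin U.
  exists v; first by rewrite -memv0 vs ?mem_head.
  by move=> U Us; apply: vs; rewrite inE Us orbT.
have {sf W0}: forall U, U \in 0%VS :: s -> U != fullv.
  by move=> U; rewrite inE => /orP[/eqP->|/sf//]; rewrite eq_sym -dimv_eq0 -lt0n.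
elim: (0%VS :: s) => [|U {}s IH] sf; first by exists 0.
have [|v vs] := IH; first by move=> V Vs; apply: sf; rewrite inE Vs orbT.
have [vU|vU] := boolP (v \in U); last first.
  by exists v => V; rewrite inE => /orP[/eqP->|/vs].
have /subvPn[w _ wU] : ~~ (fullv <= U)%VS.
  by apply: contra (sf U (mem_head _ _)) => fU; rewrite eqEsubv subvf.
suff [r hr] : exists r : seq K, forall t, t \notin r -> forall V, V \in s -> w + t *: v \notin V.
  have [t /hr ht] := closed_field_avoid r; exists (w + t *: v) => V.
  rewrite inE => /orP[/eqP->|/ht//]; apply: contra wU => wt.
  by rewrite -(addrK (t *: v) w) memvB // memvZ.
elim: s vs {IH sf} => [|V s IH] vs; first by exists [::].
have [|r hr] := IH; first by move=> V' V's; apply: vs; rewrite inE V's orbT.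
have vV := vs _ (mem_head _ _).
have [[t0 ht0]|no] := pselect (exists t, w + t *: v \in V); last first.
  exists r => t /hr ht V'; rewrite inE => /orP[/eqP->|/ht//].
  by apply/negP => ?; apply: no; exists t.
exists (t0 :: r) => t; rewrite inE negb_or => /andP[tt0 /hr ht] V'.
rewrite inE => /orP[/eqP->|/ht//]; apply: contra vV => tV.
have : (t - t0) *: v \in V.
  by rewrite scalerBl -(addrKA w) memvB // addrC.
by move/(memvZ (t - t0)^-1); rewrite scalerA mulVf ?scale1r // subr_eq0.
Qed.

(** This is how every genericity statement below is obtained: a nonempty open
    set is given as the complement of finitely many proper linear
    subspaces. *)
Lemma generically_avoid W (I : finType) (D : pred I) (U : I -> {vspace W}) :
  (0 < \dim {:W})%N -> (forall i, D i -> U i != fullv) ->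
  generically (fun x : proj W => forall i, D i -> ~~ (val x <= U i)%VS).
Proof.
move=> W0 Uf; pose O := [set x : proj W | forall i, D i -> ~~ (val x <= U i)%VS].
exists O; split=> //.
  rewrite /zariski_open (_ : ~` O = [set x | exists2 i, i \in enum D & (val x <= U i)%VS]).
    exact/closed_bigU/(fun i => closed_subspace (U i)).
  apply/seteqP; split=> x /=; last first.
    by case=> i; rewrite mem_enum => Di xi /(_ i Di); rewrite xi.
  move=> h; apply: contrapT => no; apply: h => i Di; apply/negP => xi.
  by apply: no; exists i; rewrite ?mem_enum.
have [|v v0 vs] := @avoid_subspaces W [seq U i | i <- enum D] W0.
  by move=> V /(mapP (f := U))[i iD ->]; apply: Uf; rewrite mem_enum in iD.
by exists (pt v0) => i Di; rewrite -memvE; apply/vs/(map_f U); rewrite mem_enum.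
Qed.

End Proj.

(** * Lines are irreducible of dimension one *)

Section Lines.
Variable K : closedFieldType.
Implicit Types W : vectType K.

Definition points W (U : {vspace W}) : set (proj W) := [set x | (val x <= U)%VS].

Lemma restrict_to_line n (p : {mpoly K[n]}) (x y : 'I_n -> K) :
  exists q : {poly K}, forall t, q.[t] = p.@[fun i => x i + t * y i].
Proof.
exists (\sum_(m <- msupp p) p@_m *: \prod_i ((x i)%:P + 'X * (y i)%:P) ^+ m i).
move=> t; rewrite mevalE horner_sum; apply: eq_bigr => m _.
by rewrite hornerZ horner_prod; congr (_ * _); apply: eq_bigr => i _; rewrite !hornerE.
Qed.

Lemma pt_add_neq0 W (w u : W) t : w \notin <[u]>%VS -> w + t *: u != 0.
Proof.
apply: contraNneq => /eqP; rewrite addr_eq0 => /eqP ->.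
by rewrite memvN memvZ // memv_line.
Qed.

Lemma complement_in_line W (U : {vspace W}) w :
  \dim U = 2%N -> w \in U -> w != 0 ->
  exists u, [/\ u != 0, u \in U, w \notin <[u]>%VS & U = (<[w]> + <[u]>)%VS].
Proof.
move=> dU wU w0; have /subvPn[u uU uw] : ~~ (U <= <[w]>)%VS.
  by apply/negP => /dimvS; rewrite dU dim_vline w0.
have u0 : u != 0 by apply: contraNneq uw => ->; apply: mem0v.
have wu : w \notin <[u]>%VS.
  by apply: contra uw => /(mem_line_eq w0) ->; apply: memv_line.
exists u; split=> //; apply/esym/eqP; rewrite eqEdim subv_add -!memvE wU uU dU /=.
rewrite dimv_disjoint_sum ?dim_vline ?w0 ?u0 //; apply/eqP; rewrite -subv0.
apply/subvP => x /memv_capP[/vlineP[a ->] xu]; rewrite memv0 scaler_eq0 (negPf w0) orbF.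
apply: contraNT wu => a0; have := memvZ a^-1 xu.
by rewrite scalerA mulVf // scale1r.
Qed.

Lemma points_infinite W (U : {vspace W}) : \dim U = 2%N -> infinite_set (points U).
Proof.
move=> dU; have w0 : vpick U != 0 by rewrite vpick0 -dimv_eq0 dU.
have [u [u0 uU wu _]] := complement_in_line dU (memv_pick U) w0.
pose f t := pt (pt_add_neq0 t wu).
apply: (sub_infinite_set (A := range f)).
  by move=> _ [t _ <-]; rewrite /points /= -memvE memvD ?memvZ ?memv_pick.
apply: closed_field_infinite => t t' /(congr1 val) /= Et.
have : vpick U + t *: u \in <[vpick U + t' *: u]>%VS by rewrite -Et memv_line.
case/vlineP=> a; rewrite scalerDr => /eqP; rewrite -subr_eq0 opprD addrACA scalerA -scalerBl.
rewrite -{1}[vpick U]scale1r -scalerBl => E.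
have a1 : 1 - a = 0.
  apply/eqP; apply: (contraNT _ wu) => a0; have := E; rewrite addr_eq0 => /eqP E'.
  suff : (1 - a)^-1 *: ((1 - a) *: vpick U) \in <[u]>%VS.
    by rewrite scalerA mulVf // scale1r.
  by rewrite E' !(memvZ, memvN) // memv_line.
move: E; rewrite a1 scale0r add0r scaler_eq0 (negPf u0) orbF -(subr0_eq a1) mul1r subr_eq0.
by move/eqP.
Qed.

(** If a form [p] is nonzero at a point [w] of the line, then all points of
    the line but one can be written [w + t u], and where [p] vanishes [t] is a
    root of the polynomial [p (w + t u)], which is nonzero because of its value
    at 0. *)
Lemma closed_on_line W (U : {vspace W}) (A : set (proj W)) :
  \dim U = 2%N -> zariski_closed A ->
  points U `<=` A \/ finite_set (A `&` points U).
Proof.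
move=> dU [I [Ih ->]].

have [|/existsNP[x /not_implyP[xU /existsNP[p /not_implyP[Ip px]]]]] :=
  pselect (points U `<=` zero_locus I); first by left.
right; have [d hp] := Ih _ Ip; have [w w0 xw] := pt_repr x.
have wx : w \in val x by rewrite xw memv_line.
have pw : p.@[coords w] != 0 by apply/eqP => /(vanishes_homogE hp w0 wx).
have [u [u0 _ wu EU]] := complement_in_line dU (subvP xU _ wx) w0.
have [q qE] := restrict_to_line p (coords w) (coords u).
have {}qE t : q.[t] = p.@[coords (w + t *: u)].
  by rewrite qE; apply: meval_eq => i; rewrite /coords linearD linearZ.
have q0 : q != 0.
  by apply: contraNneq pw => q0; rewrite -[w]addr0 -(scale0r u) -qE q0 horner0.
have [r Er] := closed_field_poly_normal q.
apply: (sub_finite_set (B := [set pt u0] `|` (fun t => pt (pt_add_neq0 t wu)) @` [set` r])).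
  move=> y [yI yU]; have [v v0 yv] := pt_repr y.
  have vy : v \in val y by rewrite yv memv_line.
  have := subvP yU _ vy; rewrite EU.
  case/memv_addP=> _ /vlineP[a ->] [_ /vlineP[b ->] Ev].
  have [a0|a0] := eqVneq a 0.
    left; apply: (proj_mem_eq v0 vy) => /=.
    by rewrite Ev a0 scale0r add0r memvZ // memv_line.
  have Ey : w + (b / a) *: u \in val y.
    suff -> : w + (b / a) *: u = a^-1 *: v by rewrite memvZ.
    by rewrite Ev scalerDr !scalerA mulVf // scale1r mulrC.
  right; exists (b / a); last first.
    by apply: (proj_mem_eq (pt_add_neq0 (b / a) wu)) => //=; rewrite memv_line.
  have : root q (b / a) by apply/rootP; rewrite qE; apply: yI Ey.
  by rewrite Er rootZ ?lead_coef_eq0 // root_prod_XsubC.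
by rewrite finite_setU; split; [exact: finite_set1 | exact/finite_image/finite_seq].
Qed.

Lemma closed_pt W (x : proj W) : zariski_closed [set x].
Proof.
have := closed_subspace (val x); congr zariski_closed; apply/seteqP; split=> y /=; last by move->.
have [v v0 yv] := pt_repr y; move=> yx; apply: (proj_mem_eq v0).
  by rewrite yv memv_line.
by apply: (subvP yx); rewrite yv memv_line.
Qed.

(** With one-point sets as the [F i] this shows that a finite irreducible set
    is a point; with lines, that the components of a union of lines are among
    these lines. *)
Lemma irreducible_bigU W (I : eqType) (s : seq I) (F : I -> set (proj W)) Y :
  irreducible_closed Y -> (forall i, zariski_closed (F i)) ->
  Y `<=` [set x | exists2 i, i \in s & F i x] -> exists2 i, i \in s & Y `<=` F i.
Proof.
move=> [_ [y Yy] Yi] Fc; elim: s => [|i s IH] Ys; first by have [] := Ys y Yy.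
have [|Yi0|Ys'] := Yi (F i) [set x | exists2 i, i \in s & F i x] (Fc i) (closed_bigU s Fc).
- move=> x /Ys[j]; rewrite inE => /orP[/eqP-> xi|js xj]; first by left.
  by right; exists j.
- by exists i; rewrite ?mem_head.
by have [j js Yj] := IH Ys'; exists j; rewrite // inE js orbT.
Qed.

Lemma finite_irreducible W (Y : set (proj W)) :
  irreducible_closed Y -> finite_set Y -> exists x, Y = [set x].
Proof.
move=> Yi /finite_seqP[s Es]; have [|x xs Yx] := irreducible_bigU (s := s) Yi (@closed_pt W).
  by move=> x; rewrite {1}Es => xs; exists x.
by exists x; apply/seteqP; split=> // _ ->; rewrite Es.
Qed.

Lemma irreducible_pt W (x : proj W) : irreducible_closed [set x].
Proof.
split; first exact: closed_pt.
  by exists x.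
by move=> A B _ _ /(_ x erefl)[] h; [left|right] => y ->.
Qed.

Lemma irreducible_line W (U : {vspace W}) : \dim U = 2%N -> irreducible_closed (points U).
Proof.
move=> dU; split; first exact: closed_subspace.
  by have /infinite_setN0 := points_infinite dU.
move=> A B Ac Bc UAB.
have [|fA] := closed_on_line dU Ac; first by left.
have [|fB] := closed_on_line dU Bc; first by right.
case: (points_infinite dU).
apply: (sub_finite_set (B := (A `&` points U) `|` (B `&` points U))).
  by move=> x xU; have [] := UAB x xU; [left|right].
by rewrite finite_setU.
Qed.

(** An irreducible proper closed subset of a line is finite, hence a point, so
    that no chain has length two. *)
Lemma dim_line W (U : {vspace W}) : \dim U = 2%N -> has_dim (points U) 1.
Proof.
move=> dU; have Ui := irreducible_line dU; split.
  have [_ [x xU] _] := Ui.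
  exists (fun i => if i == 0%N then [set x] else points U); split.
    case=> [|i] _ /=; last by split.
    by split; [exact: irreducible_pt | move=> y ->].
  case=> // _ /=; split; first by move=> y ->.
  move=> /sub_finite_set/(_ (finite_set1 x)); exact: points_infinite.
move=> [c [ci cl]].
have [c2i c2U] := ci 2%N isT; have [c1i _] := ci 1%N isT.
have [c0i _] := ci 0%N isT.
have [c01 n10] := cl 0%N isT; have [c12 n21] := cl 1%N isT.
have [c1c _ _] := c1i.
have [U1|] := closed_on_line dU c1c; first by case: n21 => x /c2U/U1.
rewrite (_ : _ `&` _ = c 1%N); last by apply/setIidPl => x /c12/c2U.
move=> /(finite_irreducible c1i)[x Ex]; have [_ [y y0] _] := c0i.
by apply: n10 => z; rewrite Ex => ->; have := y0; move/c01: y0; rewrite Ex => ->.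
Qed.

End Lines.

(** * Disjoint lines form a curve *)

Section Curve.
Variable K : closedFieldType.
Implicit Types W : vectType K.

Lemma card_range (I : finType) T (f : I -> T) : injective f -> range f #= `I_#|I|.
Proof.
move=> fI; have -> : range f = range (f \o @enum_val I predT).
  apply/seteqP; split=> _ [x _ <-]; last by exists (enum_val x).
  by exists (enum_rank x) => //=; rewrite enum_rankK.
rewrite (card_eqr card_II); apply: inj_card_eq => x y _ _ /fI; exact: enum_val_inj.
Qed.

Lemma dim_line_section W (U : {vspace W}) (g : 'Hom(W, K^o)) v :
  \dim U = 2%N -> v \in U -> g v != 0 -> \dim (U :&: lker g) = 1%N.
Proof.
move=> dU vU gv; have := limg_ker_dim g U; rewrite dU.
suff -> : \dim (g @: U) = 1%N by rewrite addn1 => -[].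
apply/eqP; rewrite eqn_leq lt0n dimv_eq0 -subv0; apply/andP; split.
  by apply: leq_trans (dimvS (subvf _)) _; rewrite dimvf.
by apply: contra gv => /subvP/(_ _ (memv_img g vU)); rewrite memv0.
Qed.

Definition evaluation W (v : W) (g : 'Hom(W, K^o)) : K^o := g v.

Fact evaluation_linear W (v : W) : linear (evaluation v).
Proof. by move=> a g h; rewrite /evaluation add_lfunE scale_lfunE. Qed.

HB.instance Definition _ W v :=
  GRing.isLinear.Build K _ K^o _ (@evaluation W v) (@evaluation_linear W v).

(** A hyperplane is general when its equation is nonzero at one chosen point
    of each line: it then meets each line in one point, and these points
    differ because the lines are disjoint. *)
Lemma curve_of_lines W b (L : 'I_b -> {vspace W}) :
  (0 < b)%N -> (forall k, \dim (L k) = 2%N) ->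
  (forall k l, k != l -> (L k :&: L l = 0)%VS) ->
  curve_of_degree b [set x | exists k, points (L k) x].
Proof.
move=> b0 dL Ldisj; set C := mkset _.
have Lc k : zariski_closed (points (L k)) by exact: closed_subspace.
have CE : C = [set x | exists2 k, k \in enum 'I_b & points (L k) x].
  by apply/seteqP; split=> x [k]; exists k; rewrite ?mem_enum.
have p0 k : vpick (L k) != 0 by rewrite vpick0 -dimv_eq0 dL.
split.
  split; first by rewrite CE; apply: closed_bigU.
    by exists (pt (p0 (Ordinal b0))), (Ordinal b0); rewrite /points /= -memvE memv_pick.
  move=> Y [Yi YC Ymax]; rewrite CE in YC.
  have [k _ Yk] := irreducible_bigU Yi Lc YC.
  rewrite -(Ymax _ (irreducible_line (dL k)) _ Yk); first exact: dim_line.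
  by move=> x xk; exists k.
pose ker k := lker (linfun (evaluation (vpick (L k)))).
have kerf k : ker k != fullv.
  have [|g _ gp] := @separating_form _ _ 0%VS (vpick (L k)); first by rewrite memv0.
  apply: contra gp => /eqP kf; have : g \in ker k by rewrite kf memvf.
  by rewrite memv_ker lfunE.
have [|O [Oo On Ogood]] := @generically_avoid _ _ _ predT ker _ (fun k _ => kerf k).
  rewrite lt0n; apply: contra (kerf (Ordinal b0)) => /eqP d0.
  by rewrite eqEdim subvf d0.
exists O; split=> // H /Ogood /= Hgood {O Oo On Ogood}.
have [g g0 Hg] := pt_repr H.
have gH : g \in val H by rewrite Hg memv_line.
have gp k : g (vpick (L k)) != 0.
  have := Hgood k isT; rewrite (proj_subv _ g0 gH) memv_ker lfunE; exact.
have dq k := dim_line_section (dL k) (memv_pick _) (gp k).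
pose q k : proj W := proj_of (dq k).
have -> : C `&` hyperplane H = range q.
  apply/seteqP; split=> x.
    move=> [[k xk] xH]; exists k => //; apply: val_inj => /=; apply/esym/eqP.
    rewrite eqEdim subv_cap xk dq (eqP (valP x)) leqnn andbT /=.
    by apply/subvP => v vx; rewrite memv_ker (xH _ _ gH vx).
  move=> [k _ <-]; split; first by exists k; rewrite /points /= capvSl.
  move=> f v; rewrite Hg => /vlineP[a ->] /memv_capP[_]; rewrite memv_ker => /eqP gv.
  by rewrite scale_lfunE gv scaler0.
have := @card_range _ _ q; rewrite card_ord; apply => k l Eq.
apply/eqP; apply: contraT => kl; have := dq k.
suff -> : (L k :&: lker g = 0)%VS by rewrite dimv0.
apply/eqP; rewrite -subv0 -(Ldisj _ _ kl) subv_cap capvSl.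
by rewrite [X in (X <= _)%VS](congr1 val Eq) capvSl.
Qed.

End Curve.

(** * Products of distinct linear forms are squarefree *)

Section Squarefree.
Variable K : fieldType.

Section LinearFormPrime.
Variables (n : nat) (c : 'I_n -> K) (k : 'I_n).
Hypothesis ck : c k != 0.
Let f : {mpoly K[n]} := \sum_i c i *: 'X_i.

(** The substitution that solves the equation [f = 0] for the variable [k];
    its kernel is the ideal of [f]. *)
Let sigma : n.-tuple {mpoly K[n]} :=
  [tuple if i == k then 'X_k - (c k)^-1 *: f else 'X_i | i < n].

Let sigma_f : f \mPo sigma = 0.
Proof.
have fE : f = c k *: 'X_k + \sum_(i | i != k) c i *: 'X_i by rewrite /f (bigD1 k).
have sigmaE : (\sum_(i | i != k) c i *: 'X_i) \mPo sigma = \sum_(i | i != k) c i *: 'X_i.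
  rewrite raddf_sum /=; apply: eq_bigr => i ik.
  by rewrite comp_mpolyZ comp_mpolyXU -tnth_nth tnth_mktuple (negPf ik).
rewrite {1}fE comp_mpolyD comp_mpolyZ comp_mpolyXU -tnth_nth tnth_mktuple eqxx sigmaE.
by rewrite scalerBr scalerA mulfV // scale1r addrAC -fE subrr.
Qed.

Let sub_sigma p : exists h, p - (p \mPo sigma) = f * h.
Proof.
pose P p := exists h, p - (p \mPo sigma) = f * h.
have P1 : P 1 by exists 0; rewrite comp_mpoly1 subrr mulr0.
have PM p1 p2 : P p1 -> P p2 -> P (p1 * p2).
  move=> [h1 E1] [h2 E2]; exists (h1 * p2 + (p1 \mPo sigma) * h2).
  rewrite mulrDr mulrA -E1 [f * _]mulrCA -E2 rmorphM /= mulrBl mulrBr.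
  by rewrite addrA subrK.
have PX m : P 'X_[m].
  rewrite mpolyXE_id; elim/big_ind: _ => // i _; elim: (m i) => // j IH.
  rewrite exprS; apply: PM IH; rewrite /P comp_mpolyXU -tnth_nth tnth_mktuple.
  case: eqP => [->|_]; last by exists 0; rewrite subrr mulr0.
  by exists (c k)^-1%:MP; rewrite opprB addrC subrK mulrC mul_mpolyC.
elim/mpolyind: p => [|a m p _ _ [h IH]]; first by exists 0; rewrite comp_mpoly0 subrr mulr0.
have [h' E] := PX m; exists (a *: h' + h).
by rewrite comp_mpolyD comp_mpolyZ opprD addrACA -scalerBr E IH mulrDr scalerAr.
Qed.

(** Modulo [f] every polynomial equals its image under [sigma], and [sigma f]
    is zero; hence [f] divides exactly the polynomials killed by [sigma], a
    morphism to an integral domain. *)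
Lemma linear_form_prime (p q r : {mpoly K[n]}) :
  p * q = f * r -> (exists h, p = f * h) \/ (exists h, q = f * h).
Proof.
move=> E; have : (p \mPo sigma) * (q \mPo sigma) == 0.
  by rewrite -rmorphM /= E rmorphM /= sigma_f mul0r.
rewrite mulf_eq0 => /orP[]/eqP s0; [left; have [h] := sub_sigma p | right; have [h] := sub_sigma q];
  by rewrite s0 subr0 => ->; exists h.
Qed.

End LinearFormPrime.

(** Each prime factor of the product divides [G * H], so it divides [H] and can
    be cancelled, until [1 = G * H'] is left. *)
Lemma prod_primes_cofactor n (s : seq {mpoly K[n]}) (G H : {mpoly K[n]}) :
  (forall f, f \in s -> f != 0 /\ (forall p q r, p * q = f * r ->
     (exists h, p = f * h) \/ (exists h, q = f * h))) ->
  (forall f, f \in s -> ~ exists h, G = f * h) ->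
  \prod_(f <- s) f = G * H -> (msize G <= 1)%N.
Proof.
elim: s H => [|f s IH] H sP sG.
  rewrite big_nil => E; have : G * H != 0 by rewrite -E oner_neq0.
  rewrite mulf_eq0 negb_or => /andP[G0 H0]; have := msizeM G0 H0.
  rewrite -E msize1; move: G0 H0; rewrite -!msize_poly_eq0.
  by case: (msize G) (msize H) => [|[|g]] [|h] //; rewrite !addSn !addnS.
rewrite big_cons => E; have [f0 fP] := sP _ (mem_head _ _).
have [/(sG _ (mem_head _ _))//|[h Eh]] := fP G H _ (esym E).
apply: (IH h).
- by move=> f' f's; apply: sP; rewrite inE f's orbT.
- by move=> f' f's; apply: sG; rewrite inE f's orbT.
- by apply: (mulfI f0); rewrite E Eh mulrCA.
Qed.


End Squarefree.

Lemma exists_neq d (a : 'I_d) : (1 < d)%N -> exists c, c != a.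
Proof.
move=> d1.
have [a0|a0] := eqVneq (a : nat) 0%N; [exists (Ordinal d1) | exists (Ordinal (ltnW d1))];
  by rewrite -val_eqE /= ?a0 // eq_sym.
Qed.

(** If [f a] divided [G], its square would divide the product, and [f a]
    would divide the product of the other forms, which is nonzero at [v a]
    whereas [f a] vanishes there. *)
Lemma squarefree_prod_forms (F : closedFieldType) (W : vectType F) d
    (g : 'I_d -> 'Hom(W, F^o)) (v : 'I_d -> W) :
  (forall a c, (g c (v a) == 0) = (c == a)) -> (1 < d)%N ->
  squarefree (\prod_a mpoly_of_form (g a)).
Proof.
move=> gv d1; pose f a := mpoly_of_form (g a).
have nz a : g a != 0.
  have [c ca] := exists_neq a d1; apply: contraNneq ca => g0.
  by rewrite eq_sym -gv g0 zero_lfunE.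
have fprime a : f a != 0 /\ forall p q r, p * q = f a * r ->
    (exists h, p = f a * h) \/ (exists h, q = f a * h).
  have [i gi] : exists i : 'I_(\dim {:W}), g a (vbasis {:W})`_i != 0.
    apply/existsP; apply: contraNT (nz a) => /existsPn h; apply/eqP/lfunP => u.
    rewrite (coord_vbasis (memvf u)) linear_sum zero_lfunE big1 // => i _.
    by rewrite linearZ /=; move/negbNE: (h i) => /eqP ->; rewrite scaler0.
  split; last by move=> q r s; exact: (linear_form_prime (c := fun i => g a (vbasis {:W})`_i) gi).
  by apply: contraNneq gi => f0; rewrite -meval_form -/(f a) f0 meval0.
split; first by apply/prodf_neq0 => a _; have [] := fprime a.
move=> G H E; apply: (@prod_primes_cofactor _ _ [seq f a | a <- enum 'I_d] G (G * H)).
- by move=> _ /mapP[a _ ->].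
- move=> _ /mapP[a _ ->] [h Gh].
  have E' : \prod_(c | c != a) f c = f a * (h * h * H).
    have [fa0 _] := fprime a; apply: (mulfI fa0).
    transitivity (G * G * H); first by rewrite -E [RHS](bigD1 a).
    by rewrite Gh !mulrA ![_ * f a]mulrC !mulrA.
  have /eqP := congr1 (meval (coords (v a))) E'.
  rewrite rmorph_prod mevalM meval_form (eqP (etrans (gv a a) (eqxx a))) mul0r.
  apply/negP/prodf_neq0 => c ca.
  by rewrite /f /= meval_form gv.
- by rewrite big_map big_enum /= E mulrA.
Qed.


(** * Full intersections of disjoint lines and planes *)

Section Grid.
Variables (K : closedFieldType) (W : vectType K) (b d : nat).
Variables (L : 'I_b -> {vspace W}) (g : 'I_d -> 'Hom(W, K^o)) (p : 'I_b -> 'I_d -> W).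
Hypotheses (b0 : (0 < b)%N) (d1 : (1 < d)%N).
Hypothesis dL : forall k, \dim (L k) = 2%N.
Hypothesis Ldisj : forall k l, k != l -> (L k :&: L l = 0)%VS.
Hypothesis pL : forall k a, p k a \in L k.
Hypothesis gp : forall k a c, (g c (p k a) == 0) = (c == a).

Definition grid : set (proj W) := [set x | exists k a, val x = <[p k a]>%VS].

Lemma grid_neq0 k a : p k a != 0.
Proof.
by have [c ca] := exists_neq a d1; apply: contraNneq ca => p0; rewrite -(gp k) p0 linear0.
Qed.

Lemma grid_card : grid #= `I_(b * d)%N.
Proof.
pose q (ka : 'I_b * 'I_d) := pt (grid_neq0 ka.1 ka.2).
have -> : grid = range q.
  apply/seteqP; split=> x; last by move=> [[k a] _ <-]; exists k, a.
  by move=> [k [a xka]]; exists (k, a) => //; apply: val_inj.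
have := @card_range _ _ q; rewrite card_prod !card_ord; apply.
move=> [k a] [l c] /(congr1 val) /= E.
have pl : p k a \in <[p l c]>%VS by rewrite -E memv_line.
have kl : k = l.
  apply/eqP; apply: contraT => kl; have := grid_neq0 k a.
  rewrite -memv0 -(Ldisj kl) memv_cap pL /= => /negP[].
  by apply: (subvP _ _ pl); rewrite -memvE.
subst l; congr pair; apply/eqP.
have /vlineP[t Et] := pl; have := gp k c c; rewrite eqxx => /eqP gc.
by rewrite eq_sym -(gp k) Et linearZ /= gc scaler0.
Qed.

Lemma grid_line_section k a : (L k :&: lker (g a) = <[p k a]>)%VS.
Proof.
have [c ca] := exists_neq a d1.
apply/esym/eqP; rewrite eqEdim -memvE memv_cap pL memv_ker gp eqxx /=.
by rewrite (dim_line_section (dL k) (pL k c)) ?gp 1?eq_sym // dim_vline grid_neq0.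
Qed.

(** A point of the line [L k] in the surface lies in one of the planes, and
    this plane meets the line only in the corresponding [p k a]. *)
Lemma grid_surface_section :
  [set x | exists k, points (L k) x] `&`
  zero_locus [set \prod_a mpoly_of_form (g a)] = grid.
Proof.
apply/seteqP; split=> x.
  move=> [[k xk] xF]; have [v v0 xv] := pt_repr x.
  have vx : v \in val x by rewrite xv memv_line.
  have := xF _ erefl _ vx; rewrite rmorph_prod /= => /eqP/prodf_eq0[a _].
  rewrite meval_form => gv; exists k, a.
  rewrite (val_proj_mem v0 vx); apply: mem_line_eq v0 _.
  by rewrite -grid_line_section memv_cap (subvP xk) // memv_ker.
move=> [k [a xka]]; split; first by exists k; rewrite /points /= xka -memvE.
move=> _ -> v; rewrite xka => /vlineP[t ->]; rewrite rmorph_prod /=; apply/eqP/prodf_eq0.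
exists a => //; rewrite meval_form linearZ /=.
by have := gp k a a; rewrite eqxx => /eqP ->; rewrite scaler0.
Qed.

End Grid.

Lemma grid_full_intersection (K : closedFieldType) b d
    (L : 'I_b -> {vspace 'rV[K]_4}) (g : 'I_d -> 'Hom('rV[K]_4, K^o))
    (p : 'I_b -> 'I_d -> 'rV[K]_4) :
  (0 < b)%N -> (1 < d)%N -> (forall k, \dim (L k) = 2%N) ->
  (forall k l, k != l -> (L k :&: L l = 0)%VS) ->
  (forall k a, p k a \in L k) ->
  (forall k a c, (g c (p k a) == 0) = (c == a)) ->
  full_intersection b d (grid p).
Proof.
move=> b0 d1 dL Ldisj pL gp; split; first exact: (grid_card d1 Ldisj pL gp).
exists [set x | exists k, points (L k) x], (zero_locus [set \prod_a mpoly_of_form (g a)]).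
split; first exact: curve_of_lines; last first.
  exact: (grid_surface_section d1 dL pL gp).
exists (\prod_a mpoly_of_form (g a)); split=> //; first exact: ltnW.
  have homog_prod (s : seq 'I_d) : \prod_(a <- s) mpoly_of_form (g a) \is (size s).-homog.
    elim: s => [|a s IH]; first by rewrite big_nil dhomog1.
    by rewrite big_cons; apply: (@dhomogM _ _ _ 1%N) (form_homog _) IH.
  by have := homog_prod (enum 'I_d); rewrite big_enum size_enum_ord.
by apply: (squarefree_prod_forms (v := p (Ordinal b0))) d1 => a c; apply: gp.
Qed.

(** * Projection from a general point *)

Section Projection.
Variables (K : closedFieldType) (W : vectType K) (b d : nat).
Variables (M : 'I_b -> {vspace W}) (p : 'I_b -> 'I_d -> W).
Variables (l : 'I_b -> 'I_b -> 'Hom(W, K^o)) (g h : 'I_d -> 'Hom(W, K^o)).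
Hypotheses (dimW : \dim {:W} = 5%N) (b1 : (1 < b)%N) (d1 : (1 < d)%N).
Hypothesis dM : forall k, \dim (M k) = 2%N.
Hypothesis Mdisj : forall k j, k != j -> (M k :&: M j = 0)%VS.
Hypothesis pM : forall k a, p k a \in M k.
Hypothesis lM : forall k j, k != j -> (M k <= lker (l k j))%VS /\ (M j <= lker (l k j))%VS.
Hypothesis l_neq0 : forall k j, k != j -> l k j != 0.
Hypothesis ghp : forall k a, g a (p k a) = 0 /\ h a (p k a) = 0.

(** The equation of the span of the point [p k a] and the space
    [g c = h c = 0]. *)
Let cross k a c : 'Hom(W, K^o) := (g c (p k a) : K) *: h c - (h c (p k a) : K) *: g c.
Hypothesis cross_neq0 : forall k a c, c != a -> cross k a c != 0.

Let condition (i : 'I_b * 'I_b + 'I_b * 'I_d * 'I_d) : bool :=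
  match i with inl (k, j) => k != j | inr (k, a, c) => c != a end.

Let obstruction (i : 'I_b * 'I_b + 'I_b * 'I_d * 'I_d) : 'Hom(W, K^o) :=
  match i with inl (k, j) => l k j | inr (k, a, c) => cross k a c end.

Let generic : generically (fun P : proj W =>
  forall i, condition i -> ~~ (val P <= lker (obstruction i))%VS).
Proof.
apply: generically_avoid; first by rewrite dimW.
have kerf (f : 'Hom(W, K^o)) : f != 0 -> lker f != fullv.
  apply: contraNneq => kf; apply/eqP/lfunP => v; rewrite zero_lfunE; apply/eqP.
  by rewrite -memv_ker kf memvf.
by move=> [[k j]|[[k a] c]] /= ?; apply: kerf; [exact: l_neq0 | exact: cross_neq0].
Qed.

(** The member through [w] of the pencil of hyperplanes that contain
    [g c = h c = 0]. *)
Let pencil (w : W) c : 'Hom(W, K^o) := (h c w : K) *: g c - (g c w : K) *: h c.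

Let pencilE w k a c : pencil w c (p k a) = cross k a c w.
Proof.
rewrite /pencil /cross !(add_lfunE, opp_lfunE, scale_lfunE).
by rewrite /GRing.scale /= [h c w * _]mulrC [g c w * _]mulrC.
Qed.

Let good w : Prop :=
  (forall k j, k != j -> l k j w != 0) /\ (forall k a c, c != a -> cross k a c w != 0).

Let pencil_grid w : good w -> forall k a c, (pencil w c (p k a) == 0) = (c == a).
Proof.
move=> [_ wc] k a c; have [->|ca] := eqVneq c a; last first.
  by rewrite pencilE; apply/negbTE/wc.
have [ga ha] := ghp k a.
by rewrite !(add_lfunE, opp_lfunE, scale_lfunE) ga ha !scaler0 subrr eqxx.
Qed.

(** After a projection with kernel [<[w]>], the equations [pencil w c] vanish
    on the kernel and so descend to the image; by [pencilE] they separate the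
    points as soon as the forms [cross] are nonzero at [w].  Two
    projected lines could only meet if [w] were in the span of the two lines,
    which is excluded by [l]. *)
Lemma geprofi_grid : geprofi b d (grid p).
Proof.
have [O [Oo [P0 OP0] Ogood]] := generic.
have Ow P : O P -> exists w, [/\ w != 0, val P = <[w]>%VS & good w].
  move=> /Ogood /= wP; have [w w0 Pw] := pt_repr P; exists w; split=> //.
  have wO i : condition i -> obstruction i w != 0.
    by move/wP; rewrite Pw -memvE memv_ker.
  split=> [k j kj|k a c ca]; first exact: (wO (inl (k, j))).
  exact: (wO (inr (k, a, c))).
split=> //.
  have [w [_ _ wg]] := Ow _ OP0.
  exact: (grid_card d1 Mdisj pM (pencil_grid wg)).
exists O; split=> //; first by exists P0.
move=> P /Ow[w [w0 Pw wg]] phi kphi; rewrite Pw in kphi.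
have [wl _] := wg.
have phi_l k j x : k != j -> l k j x = 0 -> phi x = 0 -> x = 0.
  move=> kj lx /eqP; rewrite -memv_ker kphi => /vlineP[t xt]; move: lx; rewrite xt linearZ /=.
  by move/eqP; rewrite scaler_eq0 (negPf (wl _ _ kj)) orbF => /eqP ->; rewrite scale0r.
(* [phi^-1] is a right inverse of [phi] on its image, so [f c] is the form
   induced on the target by [pencil w c]. *)
pose f c : 'Hom('rV[K]_4, K^o) := (pencil w c \o phi^-1)%VF.
have fE c x : f c (phi x) = pencil w c x.
  have : phi ((phi^-1)%VF (phi x)) = phi x by rewrite limg_lfunVK // memv_img ?memvf.
  rewrite comp_lfunE => /eqP; rewrite -subr_eq0 -linearB -memv_ker kphi => /vlineP[t Et].
  apply/eqP; rewrite -subr_eq0 -linearB Et linearZ /=.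
  rewrite !(add_lfunE, opp_lfunE, scale_lfunE) /GRing.scale /= [h c w * _]mulrC subrr.
  by rewrite mulr0.
have -> : proj_image phi (grid p) = grid (fun k a => phi (p k a)).
  apply/seteqP; split=> y.
    by move=> [z [k [a zka]] yz]; exists k, a; rewrite -limg_line -zka.
  move=> [k [a yka]]; exists (pt (grid_neq0 d1 (pencil_grid wg) k a)); first by exists k, a.
  by apply: etrans yka _; rewrite limg_line.
apply: (@grid_full_intersection _ _ _ (fun k => phi @: M k)%VS f) => //.
- exact: ltnW.
- move=> k; rewrite limg_dim_eq ?dM //; apply/eqP; rewrite -subv0.
  apply/subvP => x /memv_capP[xk]; rewrite memv_ker memv0 => /eqP phix.
  have [j kj] := exists_neq k b1; rewrite eq_sym in kj.
  apply/eqP/(phi_l k j) => //; apply/eqP; rewrite -memv_ker.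
  by have [/subvP-> //] := lM kj.
- move=> k j kj; apply/eqP; rewrite -subv0; apply/subvP => y /memv_capP[/memv_imgP[x xk ->]].
  move=> /memv_imgP[x' xj E]; suff : x = x'.
    move=> xx'; have : x \in (M k :&: M j)%VS by rewrite memv_cap xk xx' xj.
    by rewrite Mdisj // memv0 => /eqP ->; rewrite linear0 mem0v.
  have [lk lj] := lM kj; apply/eqP; rewrite -subr_eq0; apply/eqP/(phi_l k j _ kj).
    by apply/eqP; rewrite -memv_ker memvB ?(subvP lk _ xk) ?(subvP lj _ xj).
  by rewrite linearB /= E subrr.
- by move=> k a; apply: memv_img.
- by move=> k a c; rewrite fE pencil_grid.
Qed.

End Projection.

(** * Duads, synthemes and a total *)

Section Combinatorics.

(** A total containing the syntheme 01|23|45.  In each row the duads are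
    ordered by class: class 0 is 01 and the duads joining 23 to 45, class 1 is
    23 and those joining 01 to 45, class 2 is 45 and those joining 01 to 23. *)
Definition synthemes : seq (seq (nat * nat)) :=
  [:: [:: (0, 1); (2, 3); (4, 5)];
      [:: (3, 5); (1, 4); (0, 2)];
      [:: (2, 4); (1, 5); (0, 3)];
      [:: (2, 5); (0, 4); (1, 3)];
      [:: (3, 4); (0, 5); (1, 2)]]%N.

Definition edge (k a : nat) : nat * nat := nth (0, 0)%N (nth [::] synthemes k) a.

Definition incident (e : nat * nat) (m : nat) : nat := (m == e.1) + (m == e.2).

(** The fixed-point-free involution whose orbits are the duads of the
    syntheme [k]. *)
Definition mate (k m : nat) : nat :=
  foldr (fun e r => if m == e.1 then e.2 else if m == e.2 then e.1 else r) m (nth [::] synthemes k).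

(** Two synthemes of the total form a hexagon, in which the product of the two
    involutions is a rotation by two steps; the orbit of 0 consists of every
    second vertex. *)
Definition half_hexagon (k l : nat) : seq nat :=
  [seq iter i (mate l \o mate k) 0%N | i <- iota 0 3].

(** On both synthemes [k] and [l] this sums to zero along every duad. *)
Definition alternating (k l m : nat) : int := if m \in half_hexagon k l then 1 else -1.

(** The coefficients of the forms [x0 - x1], [x2 - x3] and [x4 - x5].  With
    those of [pairs_difference] they cut out the spans of the three classes. *)
Definition pair_difference (c m : nat) : int :=
  nth 0 (nth [::] [:: [:: 1; -1; 0; 0; 0; 0]; [:: 0; 0; 1; -1; 0; 0]; [:: 0; 0; 0; 0; 1; -1]] c) m.

(** The coefficients of [x2 + x3 - x4 - x5], [x0 + x1 - x4 - x5] and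
    [x0 + x1 - x2 - x3]. *)
Definition pairs_difference (c m : nat) : int :=
  nth 0 (nth [::] [:: [:: 0; 0; 1; 1; -1; -1]; [:: 1; 1; 0; 0; -1; -1]; [:: 1; 1; -1; -1; 0; 0]] c) m.

Definition on_edge (a : nat -> int) (e : nat * nat) : int := a e.1 + a e.2.

Definition zero_sum (a : nat -> int) : bool := foldr (fun m s => a m + s) 0 (iota 0 6) == 0.

(** Reduces the finite checks below to evaluations of boolean functions on
    natural numbers. *)
Lemma forall_iotaP n (P : nat -> bool) : all P (iota 0 n) -> forall i, (i < n)%N -> P i.
Proof. by move=> /allP h i ni; apply: h; rewrite mem_iota. Qed.

Lemma edge_lt k a : (k < 5)%N -> (a < 3)%N -> ((edge k a).1 < (edge k a).2 < 6)%N.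
Proof.
move=> k5; move: a; apply: forall_iotaP; move: k k5.
by apply: forall_iotaP; vm_compute.
Qed.

Lemma edge_surj i j : (i < j < 6)%N -> exists k a, [/\ (k < 5)%N, (a < 3)%N & edge k a = (i, j)].
Proof.
move=> /andP[ij j6]; have i6 := ltn_trans ij j6.
have : (i < j)%N ==> has (fun k => has (fun a => edge k a == (i, j)) (iota 0 3)) (iota 0 5).
  move: i i6 {ij}; apply: forall_iotaP; move: j j6.
  by apply: (forall_iotaP (P := fun j => all _ (iota 0 6))); vm_compute.
rewrite ij implyTb => /hasP[k + /hasP[a + /eqP E]]; rewrite !mem_iota => /= k5 a3.
by exists k, a.
Qed.

Lemma edge_partition k m : (k < 5)%N -> (m < 6)%N ->
  (incident (edge k 0) m + incident (edge k 1) m + incident (edge k 2) m)%N == 1%N.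
Proof.
move=> k5; move: m; apply: forall_iotaP; move: k k5.
by apply: forall_iotaP; vm_compute.
Qed.

Lemma incident_vertex k a c : (k < 5)%N -> (a < 3)%N -> (c < 3)%N ->
  incident (edge k a) (edge k c).1 == (a == c).
Proof.
move=> k5 a3; move: c; apply: forall_iotaP; move: a a3; apply: forall_iotaP; move: k k5.
by apply: forall_iotaP; vm_compute.
Qed.

Lemma incident_mate k a m : (k < 5)%N -> (a < 3)%N -> (m < 6)%N ->
  ((mate k m < 6) && (incident (edge k a) m == incident (edge k a) (mate k m)))%N.
Proof.
move=> k5 a3; move: m; apply: forall_iotaP; move: a a3; apply: forall_iotaP; move: k k5.
by apply: forall_iotaP; vm_compute.
Qed.

(** The union of two synthemes of the total is connected. *)
Lemma hexagon_connected k l m : (k < 5)%N -> (l < 5)%N -> (m < 6)%N -> k != l ->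
  m \in half_hexagon k l ++ map (mate k) (half_hexagon k l).
Proof.
move=> k5 l5 m6; apply/implyP; move: m m6; apply: forall_iotaP; move: l l5.
apply: forall_iotaP; move: k k5.
by apply: forall_iotaP; vm_compute.
Qed.

Lemma alternating_total k l : (k < 5)%N -> (l < 5)%N -> k != l ->
  [&& zero_sum (alternating k l),
      all (fun a => (on_edge (alternating k l) (edge k a) == 0) &&
                    (on_edge (alternating k l) (edge l a) == 0)) (iota 0 3) &
      has (fun k' => has (fun a => on_edge (alternating k l) (edge k' a) != 0) (iota 0 3)) (iota 0 5)].
Proof.
move=> k5 l5; apply/implyP; move: l l5; apply: forall_iotaP; move: k k5.
by apply: forall_iotaP; vm_compute.
Qed.

Lemma plane_forms c : (c < 3)%N -> zero_sum (pair_difference c) && zero_sum (pairs_difference c).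
Proof. by move: c; apply: forall_iotaP; vm_compute. Qed.

Lemma plane_contains k a : (k < 5)%N -> (a < 3)%N ->
  (on_edge (pair_difference a) (edge k a) == 0) && (on_edge (pairs_difference a) (edge k a) == 0).
Proof.
move=> k5; move: a; apply: forall_iotaP; move: k k5.
by apply: forall_iotaP; vm_compute.
Qed.

(** The combination of the two forms of class [c] that vanishes at the point
    [k a] is nonzero, as it does not vanish at some other of the fifteen
    points. *)
Lemma plane_separates k a c : (k < 5)%N -> (a < 3)%N -> (c < 3)%N -> c != a ->
  has (fun k' => has (fun a' =>
    on_edge (pair_difference c) (edge k a) * on_edge (pairs_difference c) (edge k' a') -
    on_edge (pairs_difference c) (edge k a) * on_edge (pair_difference c) (edge k' a') != 0)
    (iota 0 3)) (iota 0 5).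
Proof.
move=> k5 a3 c3; apply/implyP; move: c c3; apply: forall_iotaP; move: a a3.
apply: forall_iotaP; move: k k5.
by apply: forall_iotaP; vm_compute.
Qed.

End Combinatorics.

(** * The Cremona-Richmond configuration *)

Section Configuration.
Variable R : realType.
Local Notation C := R[i].
Local Notation V := (subvs_of (hyperplaneV R)).

Definition CR_point (k : 'I_5) (a : 'I_3) : V :=
  Subvs (vCR_in_V R (inord (edge k a).1) (inord (edge k a).2)).

Definition coordinate (x : V) (m : nat) : C := vsval x 0 (inord m).

Lemma coordinateD x y m : coordinate (x + y) m = coordinate x m + coordinate y m.
Proof. by rewrite /coordinate (_ : vsval (x + y) = vsval x + vsval y) // mxE. Qed.

Lemma coordinateZ t x m : coordinate (t *: x) m = t * coordinate x m.
Proof. by rewrite /coordinate (_ : vsval (t *: x) = t *: vsval x) // mxE. Qed.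

Lemma coordinate_inj0 x : (forall m, (m < 6)%N -> coordinate x m = 0) -> x = 0.
Proof.
move=> x0; apply/val_inj/rowP => m.
by rewrite -[m]inord_val -/(coordinate x m) x0 // mxE.
Qed.

Definition integral_form (a : nat -> int) (x : V) : C^o := \sum_(m < 6) (a m)%:~R * coordinate x m.

Fact integral_form_linear a : linear (integral_form a).
Proof.
move=> t x y; rewrite /integral_form scaler_sumr -big_split; apply: eq_bigr => m _ /=.
by rewrite coordinateD coordinateZ mulrDr mulrCA.
Qed.

HB.instance Definition _ a :=
  GRing.isLinear.Build C V C^o _ (integral_form a) (integral_form_linear a).

Lemma coordinate_point k a m : (m < 6)%N ->
  coordinate (CR_point k a) m = (incident (edge k a) m)%:R - 3%:R^-1.
Proof.
move=> m6; have /andP[e12 e6] := edge_lt (ltn_ord k) (ltn_ord a).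
rewrite /coordinate /= /vCR /evec !mxE summxE (bigD1 (inord m)) //= big1 => [|i im].
  rewrite !mxE !eqxx addr0 mulr1 /incident natrD -!(inj_eq val_inj) /=.
  by rewrite !inordK // (ltn_trans e12).
by rewrite mxE [_ == i]eq_sym (negPf im) andbF.
Qed.

Definition form a : 'Hom(V, C^o) := linfun (integral_form a).

(** For coefficients of sum zero, the correction term
    [- 1/3 (e_1 + ... + e_6)] of the points does not contribute. *)
Lemma form_point a k c : zero_sum a ->
  form a (CR_point k c) = (on_edge a (edge k c))%:~R.
Proof.
move=> /eqP a0; have /andP[e12 e6] := edge_lt (ltn_ord k) (ltn_ord c).
rewrite lfunE /= /integral_form; under eq_bigr => m _ do rewrite coordinate_point // mulrBr.
rewrite sumrB -mulr_suml (_ : \sum_(i < 6) (a i)%:~R = 0) ?mul0r ?subr0; last first.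
  by rewrite -[RHS](_ : 0%:~R = 0) // -a0 !big_ord_recl big_ord0 /= !rmorphD /=.
under eq_bigr => m _ do rewrite natrD mulrDr.
rewrite big_split /on_edge rmorphD /=; congr (_ + _).
  rewrite (bigD1 (Ordinal (ltn_trans e12 e6))) //= eqxx mulr1 big1 ?addr0 // => i ie.
  by rewrite -val_eqE /= in ie; rewrite (negPf ie) mulr0.
rewrite (bigD1 (Ordinal e6)) //= eqxx mulr1 big1 ?addr0 // => i ie.
by rewrite -val_eqE /= in ie; rewrite (negPf ie) mulr0.
Qed.

Let o0 : 'I_3 := inord 0.
Let o1 : 'I_3 := inord 1.
Let o2 : 'I_3 := inord 2.

Lemma ord3P (a : 'I_3) : [\/ a = o0, a = o1 | a = o2].
Proof.
case: a => [[|[|[|a]]]] // a3; [apply: Or31 | apply: Or32 | apply: Or33];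
  by apply: val_inj; rewrite /= inordK.
Qed.

Definition synthematic_line (k : 'I_5) : {vspace V} := (<[CR_point k o0]> + <[CR_point k o1]>)%VS.

Lemma point_in_line k a : CR_point k a \in synthematic_line k.
Proof.
have p0 : CR_point k o0 \in synthematic_line k by rewrite (subvP (addvSl _ _)) ?memv_line.
have p1 : CR_point k o1 \in synthematic_line k by rewrite (subvP (addvSr _ _)) ?memv_line.
have [->|->|->] // := ord3P a.
rewrite (_ : CR_point k o2 = - (CR_point k o0 + CR_point k o1)) ?memvN ?memvD //.
apply/eqP; rewrite -addr_eq0 addrC; apply/eqP/coordinate_inj0 => m m6.
rewrite !coordinateD !coordinate_point // !inordK //.
have := edge_partition (ltn_ord k) m6.
move: (incident _ m) (incident _ m) (incident _ m) => i0 i1 i2 /eqP.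
move/(congr1 (fun n => n%:R : C)); rewrite /= !natrD => E.
have -> : i2%:R = (i2%:R + i1%:R + i0%:R) - i1%:R - i0%:R :> C by ring.
by rewrite E; field.
Qed.

Lemma line_sub_lker k (f : 'Hom(V, C^o)) :
  f (CR_point k o0) = 0 -> f (CR_point k o1) = 0 -> (synthematic_line k <= lker f)%VS.
Proof. by move=> f0 f1; rewrite subv_add -!memvE !memv_ker f0 f1 eqxx. Qed.

(** The points of the line of a syntheme are the vectors that are constant on
    each of its duads. *)
Lemma line_coordinate k x m : (m < 6)%N -> x \in synthematic_line k ->
  coordinate x (mate k m) = coordinate x m.
Proof.
move=> m6 /memv_addP[_ /vlineP[s ->] [_ /vlineP[t ->] ->]].
have E a : coordinate (CR_point k a) (mate k m) = coordinate (CR_point k a) m.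
  have /andP[m'6 /eqP Em] := incident_mate (ltn_ord k) (ltn_ord a) m6.
  by rewrite !coordinate_point // Em.
by rewrite !coordinateD !coordinateZ !E.
Qed.

(** A common vector is constant on the duads of both synthemes, hence on the
    whole hexagon that they form; having coordinate sum zero, it vanishes. *)
Lemma lines_disjoint k l : k != l -> (synthematic_line k :&: synthematic_line l = 0)%VS.
Proof.
move=> kl; apply/eqP; rewrite -subv0; apply/subvP => x /memv_capP[xk xl].
have lt6 (j : 'I_5) m : (m < 6)%N -> (mate j m < 6)%N.
  by case/(incident_mate (ltn_ord j) (ltn_ord o0))/andP.
have iterE i : (iter i (mate l \o mate k) 0 < 6)%N /\
    coordinate x (iter i (mate l \o mate k) 0%N) = coordinate x 0.
  elim: i => // i [IH1 IH2]; rewrite iterS /=; split; first by rewrite !lt6.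
  by rewrite !line_coordinate // lt6.
have const m : (m < 6)%N -> coordinate x m = coordinate x 0.
  move=> m6; have := hexagon_connected (ltn_ord k) (ltn_ord l) m6 kl.
  rewrite mem_cat => /orP[/mapP[i _ ->]|/mapP[_ /mapP[i _ ->] ->]]; have [i6 iE] := iterE i.
    by [].
  by rewrite line_coordinate.
have x0 : coordinate x 0 = 0.
  have := subvsP x; rewrite mem_hyperplaneV.
  rewrite (eq_bigr (fun _ => coordinate x 0)); last first.
    by move=> m _; rewrite -(const m (ltn_ord m)) /coordinate inord_val.
  by rewrite sumr_const card_ord mulrn_eq0 /= => /eqP.
by rewrite memv0; apply/eqP/coordinate_inj0 => m /const ->.
Qed.

Lemma form_neq0 a : zero_sum a ->
  has (fun k => has (fun c => on_edge a (edge k c) != 0) (iota 0 3)) (iota 0 5) -> form a != 0.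
Proof.
move=> a0 /hasP[k + /hasP[c + ac]]; rewrite !mem_iota => /= k5 c3.
apply: contraNneq ac => fa0.
have := form_point (Ordinal k5) (Ordinal c3) a0.
by rewrite fa0 zero_lfunE => /esym/eqP; rewrite intr_eq0.
Qed.

Lemma coordinate_own_vertex k (a c : 'I_3) :
  coordinate (CR_point k a) (edge k c).1 = (a == c)%:R - 3%:R^-1.
Proof.
have /andP[e12 e6] := edge_lt (ltn_ord k) (ltn_ord c).
rewrite coordinate_point ?(ltn_trans e12) //.
by rewrite (eqP (incident_vertex (ltn_ord k) (ltn_ord a) (ltn_ord c))).
Qed.

Lemma dim_synthematic_line k : \dim (synthematic_line k) = 2%N.
Proof.
have o_neq : ((o0 == o1) = false) * ((o0 == o2) = false) * ((o1 == o2) = false).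
  by rewrite /o0 /o1 /o2 -!val_eqE /= !inordK.
have n3 : (3%:R : C) != 0 by rewrite pnatr_eq0.
have p0 c : CR_point k c != 0.
  apply/eqP => pc; have := coordinate_own_vertex k c c.
  rewrite pc /coordinate mxE eqxx => /esym/eqP; rewrite subr_eq0 => /eqP /(congr1 ( *%R 3%:R)).
  by rewrite mulfV // mulr1 => /eqP; rewrite -[1]/(1%:R) eqr_nat.
rewrite dimv_disjoint_sum ?dim_vline ?p0 //; apply/eqP; rewrite -subv0.
apply/subvP => x /memv_capP[/vlineP[s ->] /vlineP[t E]].
(* Compared at a vertex of duad 0 and at one of duad 2, [E] reads
   [2/3 s = - 1/3 t] and [- 1/3 s = - 1/3 t]. *)
have E0 := congr1 (fun x => coordinate x (edge k o0).1) E.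
have E2 := congr1 (fun x => coordinate x (edge k o2).1) E.
move: E0 E2; rewrite /= !coordinateZ !coordinate_own_vertex !o_neq.
rewrite [o1 == o0]eq_sym o_neq eqxx !sub0r => E0 E2.
have st : s = t by apply: (mulIf _ E2); rewrite oppr_eq0 invr_eq0.
have : s = 0 by move/eqP: E0; rewrite -st -subr_eq0 -mulrBr opprK addrNK mulr1 => /eqP.
by move->; rewrite scale0r mem0v.
Qed.

Lemma Z_CR_grid : @Z_CR R = grid CR_point.
Proof.
apply/seteqP; split=> z.
  move=> [i [j [ij zij]]]; have [|k [a [k5 a3 E]]] := @edge_surj i j; first by rewrite ij ltn_ord.
  exists (Ordinal k5), (Ordinal a3); rewrite zij; congr <[_]>%VS; apply: val_inj => /=.
  by rewrite E /= !inord_val.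
move=> [k [a zka]]; have /andP[e12 e6] := edge_lt (ltn_ord k) (ltn_ord a).
exists (inord (edge k a).1), (inord (edge k a).2); split=> //.
by rewrite !inordK // (ltn_trans e12).
Qed.

Lemma dim_V : \dim {:V} = 5%N.
Proof.
have -> : \dim {:V} = \dim (hyperplaneV R) by rewrite dimvf.
pose f := linfun (@coord_sum R).
have := limg_ker_dim f fullv; rewrite capfv dimvf (dim_matrix C 1 6 : _ = 6%N).
have -> : \dim (f @: fullv) = 1%N.
  apply/eqP; rewrite eqn_leq lt0n dimv_eq0 -subv0; apply/andP; split.
    by apply: leq_trans (dimvS (subvf _)) _; rewrite dimvf.
  apply/negP => /subvP/(_ _ (memv_img f (memvf (evec R ord0)))).
  rewrite memv0 lfunE /= /coord_sum (bigD1 ord0) //= mxE !eqxx big1 ?addr0 ?oner_eq0 // => i i0.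
  by rewrite mxE (negPf i0) andbF.
by rewrite addn1 => -[].
Qed.

End Configuration.

Theorem theorem12 (R : realType) : geprofi 5 3 (@Z_CR R).
Proof.
rewrite Z_CR_grid.
apply: (geprofi_grid (M := synthematic_line R) (l := fun k l => form R (alternating k l))
  (g := fun c => form R (pair_difference c)) (h := fun c => form R (pairs_difference c))) => //.
- exact: dim_V.
- exact: dim_synthematic_line.
- exact: lines_disjoint.
- exact: point_in_line.
- move=> k l kl; have /and3P[s0 /allP ka _] := alternating_total (ltn_ord k) (ltn_ord l) kl.
  have fe a : a \in iota 0 3 -> form R (alternating k l) (CR_point R k (inord a)) = 0 /\
      form R (alternating k l) (CR_point R l (inord a)) = 0.
    move=> aI; have /andP[/eqP ek /eqP el] := ka a aI; rewrite mem_iota in aI.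
    by rewrite !form_point // inordK // ek el.
  have [[k0 l0] [k1 l1]] := (fe 0%N isT, fe 1%N isT).
  by split; exact: line_sub_lker.
- move=> k l kl; have /and3P[s0 _ ?] := alternating_total (ltn_ord k) (ltn_ord l) kl.
  exact: form_neq0.
- move=> k a; have /andP[g0 h0] := plane_forms (ltn_ord a).
  have /andP[/eqP gk /eqP hk] := plane_contains (ltn_ord k) (ltn_ord a).
  by rewrite !form_point // gk hk.
move=> k a c ca; have /andP[g0 h0] := plane_forms (ltn_ord c).
have /hasP[k' + /hasP[a' +]] := plane_separates (ltn_ord k) (ltn_ord a) (ltn_ord c) ca.
rewrite !mem_iota => /= k'5 a'3; apply: contraNneq => f0.
have := congr1 (fun f : 'Hom(subvs_of (hyperplaneV R), R[i]^o) => f (CR_point R (Ordinal k'5) (Ordinal a'3))) f0.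
rewrite zero_lfunE !(add_lfunE, opp_lfunE, scale_lfunE) !form_point //= /GRing.scale /=.
by move/eqP; rewrite -!rmorphM -rmorphB intr_eq0.
Qed.
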